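(* Let $n\ge 2$, let $k=k(t,n)$ be any of the digital adjacencies of $\mathbb{Z}^n$, let $l\ge 5$ be a prime number, and let $SC_k^{n,l}=(x_i)_{i\in\{0,\dots,l-1\}}$ be a simple closed $k$-curve with $l$ elements in $\mathbb{Z}^n$. With the operations $x_i\ast_1 x_j=x_{i+j\,(\mathrm{mod}\,l)}$ and $x_i\star x_j=x_{i\cdot j\,(\mathrm{mod}\,l)}$, $(SC_k^{n,l},\ast_1,\star)$ is a field.
   Context: For $1\le t\le n$, two distinct points of $\mathbb{Z}^n$ are $k(t,n)$-adjacent if at most $t$ of their coordinates differ by $\pm1$ and all the other coordinates coincide; the adjacency is named by the number $k=k(t,n)=\sum_{i=1}^{t}2^i\binom{n}{i}$. A simple closed $k$-curve with $l$ elements in $\mathbb{Z}^n$ ($l\ge 4$, $n\ge 2$), denoted $SC_k^{n,l}$, is a sequence $(x_i)_{i\in\{0,\dots,l-1\}}$ of $l$ distinct points of $\mathbb{Z}^n$ such that $x_i$ and $x_j$ are $k$-adjacent if and only if $i-j\equiv\pm1\pmod l$. Indices mod $l$ are reduced to $\{0,\dots,l-1\}$. *)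

(* Defs.v *)
From HB Require Import structures.
From mathcomp Require Import all_boot all_order all_algebra.

Set Implicit Arguments.
Unset Strict Implicit.
Unset Printing Implicit Defensive.

Import Order.TTheory GRing.Theory Num.Theory.
Local Open Scope ring_scope.

(* The number k(t, n). *)
Definition adj_num (t n : nat) : nat := (\sum_(1 <= i < t.+1) 2 ^ i * 'C(n, i))%N.

Definition differ_by_one (a b : int) : bool := (a - b == 1) || (a - b == -1).

(* k(t, n)-adjacency, indexed by t. *)
Definition adjacent_at (t n : nat) (p q : 'rV[int]_n) : bool :=
  [&& p != q,
      (#|[set i | differ_by_one (p ord0 i) (q ord0 i)]| <= t)%N &
      [forall i, differ_by_one (p ord0 i) (q ord0 i) || (p ord0 i == q ord0 i)]].

(* k-adjacency, indexed by the number k; adj_num is injective in t on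
   1 <= t <= n (adjacentE below), so the witness t is unique. *)
Definition adjacent (k n : nat) (p q : 'rV[int]_n) : Prop :=
  exists t : nat, [/\ (1 <= t <= n)%N, k = adj_num t n & adjacent_at t p q].

Definition simple_closed_curve (k n l : nat) (x : 'I_l -> 'rV[int]_n) : Prop :=
  [/\ (2 <= n)%N, (4 <= l)%N, injective x &
      forall i j : 'I_l, adjacent k (x i) (x j) <->
        (i%:Z - j%:Z = 1 %[mod l%:Z])%Z \/ (i%:Z - j%:Z = -1 %[mod l%:Z])%Z].

Lemma ord_gt0 (l : nat) (i : 'I_l) : (0 < l)%N.
Proof. exact: leq_ltn_trans (leq0n i) (ltn_ord i). Qed.

Definition mod_ord (l : nat) (i : 'I_l) (m : nat) : 'I_l :=
  Ordinal (ltn_pmod m (ord_gt0 i)).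

Section CurveOperations.
Variables (n l : nat) (x : 'I_l -> 'rV[int]_n).

Definition curve : Type := {p : 'rV[int]_n | p \in codom x}.

Definition curve_pt (i : 'I_l) : curve := exist _ (x i) (codom_f x i).

Definition curve_idx (p : curve) : 'I_l := iinv (svalP p).

Definition curve_add (p q : curve) : curve :=
  let i := curve_idx p in let j := curve_idx q in
  curve_pt (mod_ord i (i + j)%N).

Definition curve_mul (p q : curve) : curve :=
  let i := curve_idx p in let j := curve_idx q in
  curve_pt (mod_ord i (i * j)%N).

Lemma curve_idxK (p : curve) : curve_pt (curve_idx p) = p.
Proof. by apply: val_inj; rewrite /= /curve_idx f_iinv. Qed.

Hypothesis x_inj : injective x.

Lemma curve_ptK (i : 'I_l) : curve_idx (curve_pt i) = i.
Proof. by apply: x_inj; rewrite /curve_idx f_iinv. Qed.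

Lemma curve_addE (i j : 'I_l) :
  curve_add (curve_pt i) (curve_pt j) = curve_pt (mod_ord i (i + j)%N).
Proof. by rewrite /curve_add !curve_ptK. Qed.

Lemma curve_mulE (i j : 'I_l) :
  curve_mul (curve_pt i) (curve_pt j) = curve_pt (mod_ord i (i * j)%N).
Proof. by rewrite /curve_mul !curve_ptK. Qed.

End CurveOperations.

Lemma adj_num_lt (n t u : nat) :
  (t < u)%N -> (u <= n)%N -> (adj_num t n < adj_num u n)%N.
Proof.
elim: u => // u IHu; rewrite ltnS => le_tu lt_un.
have ltS : (adj_num u n < adj_num u.+1 n)%N.
  rewrite /adj_num (big_nat_recr u.+1) //= -[X in (X < _)%N]addn0 ltn_add2l.
  by rewrite muln_gt0 expn_gt0 bin_gt0.
move: le_tu; rewrite leq_eqVlt => /predU1P[-> //|lt_tu].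
exact: ltn_trans (IHu lt_tu (ltnW lt_un)) ltS.
Qed.

Lemma adjacentE (t n : nat) (p q : 'rV[int]_n) : (1 <= t <= n)%N ->
  adjacent (adj_num t n) p q <-> adjacent_at t p q.
Proof.
move=> t_n; split=> [[u [u_n eq_tu adj_u]]|adj_t]; last by exists t.
case/andP: t_n => _ le_tn; case/andP: u_n => _ le_un.
case: (ltngtP t u) => [lt_tu|lt_ut|-> //].
  by have := adj_num_lt lt_tu le_un; rewrite eq_tu ltnn.
by have := adj_num_lt lt_ut le_tn; rewrite eq_tu ltnn.
Qed.

(* (T, add, mul) is a field: T carries a fieldType structure whose addition and
   multiplication are the given operations. *)
Definition is_field (T : Type) (add mul : T -> T -> T) : Prop :=
  exists F : GRing.Field T, let K : fieldType := GRing.Field.Pack F in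
    (forall a b : K, a + b = add a b) /\ (forall a b : K, a * b = mul a b).

(* Main.v *)
(* The indexing [i |-> x_i] is a bijection from Z/l onto the points of the
   curve that carries addition and multiplication mod l to the two operations,
   so the curve inherits the field structure of the prime field [F_l]. *)
Require Import Defs.
From HB Require Import structures.
From mathcomp Require Import all_boot all_order all_algebra.

Import GRing.Theory.

Section TransportField.
Variables (F : fieldType) (T : Type) (f : T -> F) (g : F -> T).
Hypotheses (fK : cancel f g) (gK : cancel g f).
Local Open Scope ring_scope.

(** An alias of [T] whose type records both cancellation proofs, so that instance inference can
    recover [f] and [g] from the carrier. *)
Definition transported of cancel f g & cancel g f : Type := T.
Local Notation K := (transported fK gK).

Definition tr_zero : K := g 0.
Definition tr_one : K := g 1.
Definition tr_opp (a : K) : K := g (- f a).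
Definition tr_inv (a : K) : K := g (f a)^-1.
Definition tr_add (a b : K) : K := g (f a + f b).
Definition tr_mul (a b : K) : K := g (f a * f b).

HB.instance Definition _ := Choice.copy K (can_type fK).

Fact tr_addA : associative tr_add.
Proof. by move=> a b c; rewrite /tr_add !gK addrA. Qed.
Fact tr_addC : commutative tr_add.
Proof. by move=> a b; rewrite /tr_add addrC. Qed.
Fact tr_add0 : left_id tr_zero tr_add.
Proof. by move=> a; rewrite /tr_add gK add0r fK. Qed.
Fact tr_addN : left_inverse tr_zero tr_opp tr_add.
Proof. by move=> a; rewrite /tr_add gK addNr. Qed.
HB.instance Definition _ :=
  GRing.isZmodule.Build K tr_addA tr_addC tr_add0 tr_addN.

Fact tr_mulA : associative tr_mul.
Proof. by move=> a b c; rewrite /tr_mul !gK mulrA. Qed.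
Fact tr_mulC : commutative tr_mul.
Proof. by move=> a b; rewrite /tr_mul mulrC. Qed.
Fact tr_mul1 : left_id tr_one tr_mul.
Proof. by move=> a; rewrite /tr_mul gK mul1r fK. Qed.
Fact tr_mulDl : left_distributive tr_mul tr_add.
Proof. by move=> a b c; rewrite /tr_mul /tr_add !gK mulrDl. Qed.
Fact tr_one_neq0 : tr_one != 0 :> K.
Proof. by apply/eqP => /(can_inj gK)/eqP; rewrite oner_eq0. Qed.
HB.instance Definition _ := GRing.Zmodule_isComNzRing.Build K
  tr_mulA tr_mulC tr_mul1 tr_mulDl tr_one_neq0.

Fact tr_mulV (a : K) : a != 0 -> tr_inv a * a = 1.
Proof.
move=> a_neq0; have fa_neq0 : f a != 0.
  by apply: contra_neq a_neq0 => fa0; rewrite -[a]fK fa0.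
by rewrite /GRing.mul /= /tr_mul gK mulVf.
Qed.
Fact tr_inv0 : tr_inv 0 = 0.
Proof. by rewrite /tr_inv gK invr0. Qed.
HB.instance Definition _ := GRing.ComNzRing_isField.Build K tr_mulV tr_inv0.

(** The alias [K] unfolds to [T], so its field class is one on [T] itself. Since [f] is injective,
    the operations may be compared in [F], where [gK] evaluates those of [K]. *)
Lemma is_field_can (add mul : T -> T -> T) :
    {morph f : a b / add a b >-> a + b} ->
    {morph f : a b / mul a b >-> a * b} ->
  is_field add mul.
Proof.
move=> fD fM; exists (GRing.Field.class K); split=> a b; apply: (can_inj fK).
  by rewrite fD; apply: gK.
by rewrite fM; apply: gK.
Qed.

End TransportField.

Theorem lemma5p7 (n t k l : nat) (x : 'I_l -> 'rV[int]_n)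
    (hn : (2 <= n)%N) (ht : (1 <= t <= n)%N) (hk : k = adj_num t n)
    (hl5 : (5 <= l)%N) (hl : prime l) (hx : simple_closed_curve k x) :
  is_field (@curve_add n l x) (@curve_mul n l x).
Proof.
have [_ _ x_inj _] := hx.
pose f (p : curve x) : 'F_l := (curve_idx p)%:R%R.
(* The bound of ['F_l] is computed from [pdiv l], so a residue is not literally an ['I_l]. [mod_ord]
   changes the type but not the value, which is already below [l]; the ordinal 0 supplies
   [0 < l]. *)
pose g (a : 'F_l) : curve x :=
  curve_pt x (mod_ord (Ordinal (prime_gt0 hl)) a).
have fK : cancel f g.
  move=> p; rewrite -[RHS]curve_idxK; congr (curve_pt x _).
  (* Both the cast to ['F_l] and [g] reduce mod [l], which fixes an index below [l]. *)
  by apply: val_inj; rewrite /= val_Fp_nat // modn_mod modn_small.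
have gK : cancel g f.
  by move=> a; rewrite /f curve_ptK //= Fp_nat_mod // natr_Zp.
(* The result's index is reduced mod [l]; as [l] vanishes in ['F_l], the cast forgets this reduction
   and respects sums and products. *)
apply: (is_field_can _ _ _ _ fK gK) => p q.
  by rewrite /f curve_ptK //= Fp_nat_mod // natrD.
by rewrite /f curve_ptK //= Fp_nat_mod // natrM.
Qed.
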